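(* For every integer $n\ge 2$ and every Boolean algebra $\mathbb{B}$, $\mathfrak{r}_n(\mathbb{B})\le\mathfrak{r}_2(\mathbb{B})^+$.
   Context: For a Boolean algebra $\mathbb{B}$, an $n$-partition is a set $R$ of $n$ elements of $\mathbb{B}$ with $\bigvee R=1$ and pairwise meets $0$. A set $A\subseteq\mathbb{B}$ is $n$-reaped by $R$ if $R$ is an $n$-partition and every $a\in A$ satisfies $|\{b\in R:b\wedge a\ne0\}|\ge 2$. $\mathfrak{r}_n(\mathbb{B})$ is the least cardinality of a subset of $\mathbb{B}\setminus\{0\}$ not $n$-reaped by any $n$-partition of $\mathbb{B}$. $\kappa^+$ denotes the successor cardinal. *)

(* Defs.v *)
From mathcomp Require Import all_boot all_order finmap.
From mathcomp Require Import boolp classical_sets functions cardinality.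

Set Implicit Arguments.
Unset Strict Implicit.
Unset Printing Implicit Defensive.

Import Order.Theory.

Local Open Scope classical_set_scope.
Local Open Scope card_scope.

(* A cardinal number is represented by any set having that cardinality, and
   cardinals are compared by [#<=].  Both cardinals below are selected by [xget]
   among the sets with the defining property; such sets exist ([succ_cardP],
   and, for [2 <= n], [reaping_numberP]) and are unique up to equipotence. *)

Definition is_succ_card T U (A : set T) (K : set U) : Prop :=
  [/\ A #<= K, ~ (K #<= A) &
      forall V (X : set V), A #<= X -> ~ (X #<= A) -> K #<= X].

(* By Cantor's theorem a successor of [A] can be found among the sets of subsets
   of [T].  On finite sets this is the usual successor of integers. *)
Definition succ_card T (A : set T) : set (set T) :=
  xget set0 [set K | is_succ_card A K].

Section Reaping.
Context {d : Order.disp_t} {B : ctbDistrLatticeType d}.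
Local Open Scope order_scope.

(* The elements of [R] are distinct, and one of them may be [\bot]. *)
Definition is_partition (n : nat) (R : {fset B}) : Prop :=
  [/\ #|` R|%fset = n,
      \join_(b <- R) b = \top &
      {in R &, forall b c, b != c -> b `&` c = \bot}].

Definition reaped_by (n : nat) (A : set B) (R : {fset B}) : Prop :=
  is_partition n R /\
  forall a, A a -> (2 <= #|` [fset b in R | (b `&` a)%O != \bot]|%fset)%N.

Definition unreaped (n : nat) (A : set B) : Prop :=
  (forall a, A a -> a != \bot) /\ forall R : {fset B}, ~ reaped_by n A R.

Definition is_reaping_number (n : nat) (A : set B) : Prop :=
  unreaped n A /\ forall A' : set B, unreaped n A' -> (A #<= A')%card.

End Reaping.

Definition reaping_number (n : nat) {d : Order.disp_t}
    (B : ctbDistrLatticeType d) : set B :=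
  xget set0 [set A | is_reaping_number n A].
Arguments reaping_number n {d} B.

Lemma ex_min_card (I : Type) (i0 : I) (T : I -> Type) (A : forall i, set (T i)) :
  exists i, forall j, A i #<= A j.
Proof.
pose P (F : set (forall i, T i)) :=
  (forall f, F f -> forall i, A i (f i)) /\
  (forall f g, F f -> F g -> forall i, f i = g i -> f = g).
have [F [[FA Finj] Fmax]] : exists F, P F /\ forall G, F `<` G -> ~ P G.
  apply: Zorn_bigcup => C CP Ctot; split=> [f [G CG Gf]|f g [G CG Gf] [H CH Hg]].
    by have [GA _] := CP _ CG; exact: GA.
  have [GH|HG] := Ctot _ _ CG CH.
  - by have [_ Hinj] := CP _ CH; apply: Hinj => //; exact: GH.
  - by have [_ Ginj] := CP _ CG; apply: Ginj => //; exact: HG.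
have [i Fi] : exists i, A i `<=` (fun f => f i) @` F.
  apply: contrapT => /forallNP nF.
  have {}nF i : exists x, A i x /\ ~ ((fun f => f i) @` F) x.
    by apply: contrapT => /forallNP nx; apply: (nF i) => x Ax;
      apply: contrapT => nFx; exact: (nx x).
  pose h i := sval (cid (nF i)).
  have hA i : A i (h i) by rewrite /h; case: cid => ? [].
  have hF i f : F f -> f i <> h i.
    by rewrite /h; case: cid => x /= [_ nx] Ff fx; apply: nx; exists f.
  apply: (Fmax (F `|` [set h])).
    split; first by move=> f; left.
    by move=> /(_ h (or_intror erefl)) /(hF i0).
  split=> [f [/FA //|-> //]|f g [Ff|->] [Fg|->] i // fg].
  - exact: Finj fg.
  - by case: (hF i f).
  - by case: (hF i g).
exists i => j; apply: card_le_trans (subset_card_le Fi) _.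
apply: card_le_trans (card_image_le _ _) _.
have FE : (fun f => f j) @` F #= F.
  by apply: inj_card_eq => f g /set_mem Ff /set_mem Fg; exact: Finj.
rewrite -(card_le_eql FE); apply: subset_card_le => _ [f Ff <-]; exact: FA.
Qed.

Lemma card_le_total T U (A : set T) (B : set U) : A #<= B \/ B #<= A.
Proof.
pose X b : {V : Type & set V} := if b then existT _ T A else existT _ U B.
have [[] /= XX] := @ex_min_card bool true _ (fun b => projT2 (X b)).
- by left; exact: (XX false).
- by right; exact: (XX true).
Qed.

Lemma succ_cardP T (A : set T) : is_succ_card A (succ_card A).
Proof.
apply: (@xgetPex _ set0 [set K | is_succ_card A K]).
pose large (K : set (set T)) := ~ (K #<= A).
have largeT : large setT.
  move=> le; have : [set: set T] #<= [set: T] by apply: card_le_trans le (card_leT _).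
  move=> /pcard_surjP[g gsurj].
  have [x _ gx] := gsurj [set x | ~ g x x] I.
  have nxx : ~ g x x by move=> gxx; have := gxx; rewrite {1}gx; exact.
  by apply: (nxx); rewrite gx.
have [[K largeK] Kmin] := @ex_min_card {K | large K} (exist _ _ largeT)
  (fun=> set T) (fun K => sval K).
have AK V (X : set V) : ~ (X #<= A) -> A #<= X.
  by move=> nXA; have [|//] := card_le_total X A.
exists K; split; [exact: AK|exact: largeK|move=> V X _ nXA].
have [//|XK] := card_le_total K X.
have /card_subP[Y YX _] := XK.
have largeY : large Y by rewrite /large (card_le_eql YX).
by rewrite -(card_le_eqr YX); exact: (Kmin (exist _ Y largeY)).
Qed.

Lemma reaping_numberP (n : nat) {d : Order.disp_t} (B : ctbDistrLatticeType d) :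
  (2 <= n)%N -> is_reaping_number n (reaping_number n B).
Proof.
move=> n2; apply: (@xgetPex _ set0 [set A | is_reaping_number n A]).
have unr : @unreaped d B n [set a | a != \bot%O].
  split=> // R [[Rn _ Rdisj] Rreap].
  have [b bR b0] : exists2 b, b \in R & b != \bot%O.
    apply: contrapT => nb; suff : (#|` R|%fset <= 1)%N by rewrite Rn leqNgt n2.
    rewrite -(cardfs1 (\bot%O : B)); apply: fsubset_leq_card.
    apply/fsubsetP => b bR; rewrite inE; apply: contrapT => /negP b0.
    by apply: nb; exists b.
  have := Rreap _ b0; rewrite ltnNge => /negP; apply.
  rewrite -(cardfs1 b); apply: fsubset_leq_card.
  apply/fsubsetP => c; rewrite !inE /= => /andP[cR].
  by apply: contraR => cb; rewrite (Rdisj _ _ cR bR cb).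
have [[A unrA] Amin] := @ex_min_card {A : set B | unreaped n A}
  (exist _ _ unr) (fun=> B) (fun A => sval A).
by exists A; split=> // A' unrA'; exact: (Amin (exist _ A' unrA')).
Qed.

(* Main.v *)
(* Let [A] be a smallest set that no 2-partition reaps, let [kappa = |A|], and
   suppose that every set of at most [kappa^+] elements is n-reaped.  If [A] is
   finite, then reaping singletons makes the algebra atomless and [A] could be
   reaped.  Otherwise build n-partitions [p_alpha], [alpha < kappa^+], each
   reaping everything generated by [A] and its predecessors, and a finite family
   [q] of disjoint elements such that every nonzero element of the set [Z]
   generated by [A] and all the [p_alpha] meets at least [n] members of [q].
   A two-colouring of the cells of [p_alpha1], ..., [p_alphak], [q] gives an
   element [c], and some [a] in [A] lies below [c] or below its complement; as
   [kappa^+] is regular, the same [a] serves for unboundedly many [alpha1],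
   then unboundedly many [alpha2], and so on.  Take [y <= a] in [Z] meeting a
   minimal set [D] of members of [q].  One can follow a path through the
   p-cells met by [y], with at least two children available at each step and
   without ever shrinking [D].  The colouring is arranged so that each (D, colour)
   is harmful along at most one child of each node, and at most [n] such
   pairs survive at a leaf, where a colouring not constant on any surviving [D]
   exists because each [D] has at least [n] elements. *)
Require Import Defs.
From mathcomp Require Import all_boot all_order finmap.
From mathcomp Require Import boolp classical_sets functions cardinality wochoice.

Set Implicit Arguments.
Unset Strict Implicit.
Unset Printing Implicit Defensive.

Import Order.Theory.

Local Open Scope classical_set_scope.
Local Open Scope card_scope.

(** * Products and unions of infinite cardinals *)

Lemma card_le_inj T U (A : set T) (B : set U) (f : T -> U) :
  (forall x, A x -> B (f x)) ->
  (forall x y, A x -> A y -> f x = f y -> x = y) -> A #<= B.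
Proof.
move=> AB fI; have /injfunPex[g] : exists2 g : T -> U, set_fun A B g & set_inj A g.
  by exists f => // x y /set_mem Ax /set_mem Ay; exact: fI.
exact: inj_card_le.
Qed.

Lemma card_le_fun T U (A : set T) (B : set U) (u : U) : A #<= B ->
  exists f : T -> U, (forall x, A x -> B (f x)) /\
    (forall x y, A x -> A y -> f x = f y -> x = y).
Proof.
case: (pselect (exists x, A x)) => [[x0 Ax0]|A0] AB; last first.
  by exists (fun=> u); split=> [x Ax|x y Ax]; case: A0; exists x.
have /card_leP[g] := AB.
pose h x := if pselect (A x) is left Ax then \val (g (SigSub (mem_set Ax))) else u.
have hE x (Ax : A x) : h x = \val (g (SigSub (mem_set Ax))).
  by rewrite /h; case: pselect => // Ax'; rewrite (Prop_irrelevance Ax Ax').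
exists h; split=> [x Ax|x y Ax Ay].
  by rewrite (hE _ Ax); apply: set_mem; exact: valP.
rewrite (hE _ Ax) (hE _ Ay) => /val_inj gxy.
by have /(congr1 val) : SigSub (mem_set Ax) = SigSub (mem_set Ay) :> A
  by apply: inj gxy; rewrite inE.
Qed.

Definition pairing T (X : set T) (f : T * T -> T) : Prop :=
  (forall p, (X `*` X) p -> X (f p)) /\
  (forall p q, (X `*` X) p -> (X `*` X) q -> f p = f q -> p = q).

Lemma pairing_inj T (X : set T) (f : T * T -> T) x y z t : pairing X f ->
  X x -> X y -> X z -> X t -> f (x, y) = f (z, t) -> x = z /\ y = t.
Proof.
move=> [_ fI] Xx Xy Xz Xt E.
by have [] : (x, y) = (z, t) by apply: fI.
Qed.

(** For distinct [b0] and [b1] in [X], the pairs starting with [b0] and those starting with [b1]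
    form two disjoint copies of [X]: one receives [X], the other [Y]. *)
Lemma pairing_setU T (X Y : set T) (f : T * T -> T) :
  infinite_set X -> pairing X f -> X `&` Y = set0 -> Y #<= X ->
  X `|` Y #<= X.
Proof.
move=> Xinf Xf XY YX; have [fX _] := Xf; have fI := pairing_inj Xf.
have [b0 Xb0] := infinite_setN0 Xinf.
have [b1 [Xb1 b10]] : exists b, X b /\ b <> b0.
  apply: contrapT => nb; apply: Xinf; apply: (@sub_finite_set _ _ [set b0]) => //.
  by move=> x Xx /=; apply: contrapT => xb; apply: nb; exists x.
have [k [kX kI]] := card_le_fun b0 YX.
have nXY x : X x -> Y x -> False.
  by move=> Xx Yx; have : (X `&` Y) x by []; rewrite XY.
pose e x := if pselect (X x) then f (b0, x) else f (b1, k x).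
apply: (@card_le_inj _ _ _ _ e) => [x XYx|x y XYx XYy]; rewrite /e.
  case: pselect => [Xx|nXx]; first by apply: fX.
  by case: XYx => // Yx; apply: fX; split => //=; exact: kX.
case: pselect => [Xx|nXx]; case: pselect => [Xy|nXy].
- by move=> E; have [] := fI _ _ _ _ Xb0 Xx Xb0 Xy E.
- case: XYy => // /kX Xk E.
  by have [/esym] := fI _ _ _ _ Xb0 Xx Xb1 Xk E.
- case: XYx => // /kX Xk E.
  by have [] := fI _ _ _ _ Xb1 Xk Xb0 Xy E.
- case: XYx => // Yx; case: XYy => // Yy E.
  have [_] := fI _ _ _ _ Xb1 (kX _ Yx) Xb1 (kX _ Yy) E.
  exact: kI.
Qed.

(* Zorn's lemma gives a maximal [X] with an injection of [X * X] into [X]; if [A]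
   were larger than [X], a copy of [X] inside [A `\` X] would extend it. *)
Lemma infinite_setX_le T (A : set T) : infinite_set A -> A `*` A #<= A.
Proof.
move=> Ainf; have [x0 _] := infinite_setN0 Ainf.
pose good (Xf : set T * (T * T -> T)) :=
  [/\ infinite_set Xf.1, Xf.1 `<=` A & pairing Xf.1 Xf.2].
pose R (s t : {Xf | good Xf}) := `[< (sval s).1 `<=` (sval t).1 /\
  (forall p, ((sval s).1 `*` (sval s).1) p -> (sval s).2 p = (sval t).2 p) >].
have [t0 _] : exists t : {Xf | good Xf}, True.
  have /infiniteP /card_subP[N Nnat NA] := Ainf.
  have Ninf : infinite_set N.
    by apply/infiniteP; rewrite (card_le_eql (_ : [set: nat] #= N)) 1?card_eq_sym.
  have : N `*` N #<= N.
    have /andP[NN _] : (N #<= [set: nat]) && ([set: nat] #<= N).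
      by rewrite -card_eq_le.
    have [c [_ cI]] := card_le_fun 0%N NN.
    have : [set: nat * nat] #<= N.
      rewrite (card_le_eqr Nnat).
      by have := card_nat2; rewrite card_eq_le => /andP[].
    apply: card_le_trans; apply: (@card_le_inj _ _ _ _ (fun p => (c p.1, c p.2))) => //.
    move=> [x y] [z t] /= [Nx Ny] [Nz Nt] [xz yt].
    by rewrite (cI x z) // (cI y t).
  move=> /(card_le_fun x0)[f [fN fI]].
  by unshelve eexists (exist _ (N, f) _) => //; split.
have [||C Ctot|t tmax] := @ZL_preorder _ t0 R.
- by move=> s; apply/asboolP; split.
- move=> r s t /asboolP[rs rsE] /asboolP[st stE]; apply/asboolP; split.
    exact: subset_trans st.
  move=> p [p1 p2]; rewrite rsE; last by split.
  by apply: stE; split; exact: rs.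
- have [[s0 Cs0]|C0] := pselect (exists s, C s); last first.
    by exists t0 => s Cs; case: C0; exists s.
  pose X := \bigcup_(s in C) (sval s).1.
  (* The values at [p] of the members of the chain defined there; they agree, so the union of the
     chain is again a pairing. *)
  pose V p : set T := [set z | exists s, [/\ C s, ((sval s).1 `*` (sval s).1) p
    & z = (sval s).2 p]].
  have /choice[f fV] : forall p, exists z, (exists z', V p z') -> V p z.
    move=> p; have [[z Vz]|nV] := pselect (exists z, V p z); first by exists z.
    by exists x0 => /nV.
  have fE s p : C s -> ((sval s).1 `*` (sval s).1) p -> f p = (sval s).2 p.
    move=> Cs sp; have [s' [Cs' s'p ->]] : V p (f p).
      by apply: fV; exists ((sval s).2 p), s.
    by have [|] := Ctot _ _ Cs Cs' => /asboolP[_ E]; rewrite E.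
  have XX p q : (X `*` X) p -> (X `*` X) q -> exists s,
      [/\ C s, ((sval s).1 `*` (sval s).1) p & ((sval s).1 `*` (sval s).1) q].
    have two s s' : C s -> C s' -> exists s'', [/\ C s'', R s s'' & R s' s''].
      have Rxx r : R r r by apply/asboolP; split.
      by move=> Cs Cs'; have [|] := Ctot _ _ Cs Cs'; [exists s'|exists s].
    move=> [[a Ca pa] [b Cb pb]] [[c Cc qc] [e Ce qe]].
    have [u [Cu /asboolP[au _] /asboolP[bu _]]] := two _ _ Ca Cb.
    have [v [Cv /asboolP[cv _] /asboolP[ev _]]] := two _ _ Cc Ce.
    have [w [Cw /asboolP[uw _] /asboolP[vw _]]] := two _ _ Cu Cv.
    exists w; split=> //; split.
    + by apply: uw; exact: au.
    + by apply: uw; exact: bu.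
    + by apply: vw; exact: cv.
    + by apply: vw; exact: ev.
  have gX : good (X, f).
    split=> /=.
    + have [Yinf _ _] := proj2_sig s0; apply: sub_infinite_set Yinf => x s0x.
      by exists s0.
    + by move=> x [s _ sx]; have [_ sA _] := proj2_sig s; exact: sA.
    + split=> [p Xp|p q Xp Xq].
        have [s [Cs sp _]] := XX _ _ Xp Xp; rewrite (fE s) //.
        by exists s => //; have [_ _ [+ _]] := proj2_sig s; apply.
      have [s [Cs sp sq]] := XX _ _ Xp Xq; rewrite !(fE s) //.
      by have [_ _ [_]] := proj2_sig s; apply.
  exists (exist _ _ gX) => s Cs; apply/asboolP; split=> /= [x sx|p sp].
    by exists s.
  by rewrite (fE s).
- case: t tmax => -[X f] tP tmax.
  have [Xinf XA Xf] : [/\ infinite_set X, X `<=` A & pairing X f] := tP.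
  have XD : X `|` (A `\` X) = A.
    apply/seteqP; split=> [x [/XA //|[]//]|x Ax].
    by have [?|?] := pselect (X x); [left|right].
  have XID Y : Y `<=` A `\` X -> X `&` Y = set0.
    by move=> YD; rewrite -subset0 => x [Xx /YD[]].
  have [DX|/card_subP[Y YX YA]] := card_le_total (A `\` X) X.
    have AX : A #<= X.
      rewrite -{1}XD; apply: (pairing_setU Xinf Xf) => //.
      by apply: XID.
    have [e [eX eI]] := card_le_fun x0 AX.
    apply: (@card_le_inj _ _ _ _ (fun p => f (e p.1, e p.2))).
      by move=> p [p1 p2]; apply: XA; apply: Xf.1; split; exact: eX.
    move=> [x y] [z u] /= [Ax Ay] [Az Au] E.
    have [] := pairing_inj Xf (eX _ Ax) (eX _ Ay) (eX _ Az) (eX _ Au) E.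
    by move=> /eI -> // /eI ->.
  exfalso; have := YX; rewrite card_eq_le => /andP[YX1 XY1].
  have [h [hY hI]] := card_le_fun x0 XY1.
  have XY0 := XID _ YA.
  have [e [eX eI]] := card_le_fun x0 (pairing_setU Xinf Xf XY0 YX1).
  have nXh x : X x -> ~ X (h x) by move=> /hY /YA[].
  (* A pair outside the old domain is squeezed into [X] by [e], coded there by [f], and its code is
     moved by [h] into [Y], away from the old codes. *)
  pose g p := if pselect ((X `*` X) p) then f p else h (f (e p.1, e p.2)).
  have eXX p : ((X `|` Y) `*` (X `|` Y)) p -> (X `*` X) (e p.1, e p.2).
    by case=> ? ?; split; exact: eX.
  have gg : good (X `|` Y, g).
    split=> /=.
    + by apply: sub_infinite_set Xinf; left.
    + by move=> x [/XA //|/YA[]].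
    + split=> [p Xp|p q Xp Xq]; rewrite /g.
        case: pselect => [pX|npX]; first by left; exact: Xf.1.
        by right; apply: hY; apply: Xf.1; exact: eXX.
      have Xep := Xf.1 _ (eXX _ Xp); have Xeq := Xf.1 _ (eXX _ Xq).
      case: pselect => [pX|npX]; case: pselect => [qX|nqX].
      * exact: Xf.2.
      * by move=> /= E; case: (nXh _ Xeq); rewrite -E; exact: Xf.1.
      * by move=> /= E; case: (nXh _ Xep); rewrite E; exact: Xf.1.
      * move=> /(hI _ _ Xep Xeq) /(Xf.2 _ _ (eXX _ Xp) (eXX _ Xq)).
        case: p q {npX nqX Xep Xeq} Xp Xq => [x y] [z u] /= [? ?] [? ?].
        by case=> /eI -> // /eI ->.
  have [x Xx] := infinite_setN0 Xinf.
  have /asboolP[/= YX' _] : R (exist _ _ gg) (exist _ (X, f) tP).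
    apply: tmax; apply/asboolP; split=> /= [z|p Xp]; first by left.
    by rewrite /g; case: pselect.
  by apply: (nXh x) => //; apply: YX'; right; exact: hY.
Qed.

(** A point is coded by an index chosen for it together with its code in that member; [K] absorbs
    its own square. *)
Lemma infinite_bigcup_le I T U (K : set U) (D : set I) (F : I -> set T) :
  infinite_set K -> D #<= K -> (forall i, D i -> F i #<= K) ->
  \bigcup_(i in D) F i #<= K.
Proof.
move=> Kinf DK FK; have [u0 _] := infinite_setN0 Kinf.
have [[i0 Di0]|D0] := pselect (exists i, D i); last first.
  rewrite (_ : \bigcup_(i in D) F i = set0) // -subset0 => x [i Di _].
  by case: D0; exists i.
have [f [fK fI]] := card_le_fun u0 (infinite_setX_le Kinf).
have [g [gK gI]] := card_le_fun u0 DK.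
have /choice[h hP] : forall i, exists h : T -> U, D i ->
    (forall x, F i x -> K (h x)) /\
    (forall x y, F i x -> F i y -> h x = h y -> x = y).
  move=> i; have [Di|nDi] := pselect (D i); last by exists (fun=> u0).
  by have [h hP] := card_le_fun u0 (FK i Di); exists h.
have /choice[j jP] : forall x, exists i,
    (\bigcup_(i in D) F i) x -> D i /\ F i x.
  move=> x; have [[i Di Fx]|nF] := pselect ((\bigcup_(i in D) F i) x).
    by exists i.
  by exists i0 => /nF.
apply: (@card_le_inj _ _ _ _ (fun x => f (g (j x), h (j x) x))).
  move=> x /jP[Dj Fj]; apply: fK; split; first exact: gK.
  by apply: (hP _ Dj).1.
move=> x y /jP[Dx Fx] /jP[Dy Fy] E.
have [] := pairing_inj (conj fK fI) (gK _ Dx) ((hP _ Dx).1 _ Fx)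
  (gK _ Dy) ((hP _ Dy).1 _ Fy) E.
move=> /(gI _ _ Dx Dy) jxy; rewrite jxy.
by apply: (hP _ Dy).2 => //; rewrite -jxy.
Qed.

Lemma infinite_setU_le T U (K : set U) (X Y : set T) :
  infinite_set K -> X #<= K -> Y #<= K -> X `|` Y #<= K.
Proof.
move=> Kinf XK YK; rewrite -bigcup2E; apply: infinite_bigcup_le => //.
  exact/infiniteP.
by move=> [|[|i]] _.
Qed.

(** * A tower of partitions of length a successor cardinal *)

(* [T] plays the part of the ordinal [kappa^+], where [kappa = |A|]. *)
Lemma well_founded_long U V (K : set U) (A : set V) :
  infinite_set A -> ~ (K #<= A) ->
  exists (T : set U) (lt : U -> U -> Prop),
    [/\ T `<=` K, well_founded lt,
        forall x y z, lt x y -> lt y z -> lt x z,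
        forall x, T x -> [set y | T y /\ ~ lt x y] #<= A & ~ (T #<= A)].
Proof.
elim/Peq: U K => U K Ainf KA.
have [R wR] := well_ordering_principle U.
have Rmin (S : set U) : (exists x, S x) -> exists2 x, S x & forall y, S y -> R x y.
  move=> [x Sx]; have [|z [[zS zmin] _]] := wR (mem S).
    by exists x; exact/mem_set.
  by exists z; [exact/set_mem|move=> y Sy; apply: zmin; exact/mem_set].
have Ranti x y : R x y -> R y x -> x = y.
  move=> xy yx; apply: (@wo_chain_antisymmetric U R predT (withinW wR)) => //.
  exact/andP.
pose lt x y : Prop := ~~ R y x.
have ltwf : well_founded lt.
  move=> x; apply: contrapT => nx.
  have [|z nz zmin] := Rmin [set y | ~ Acc lt y]; first by exists x.
  by apply: nz; split=> y; rewrite /lt; apply: contraNP => /zmin.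
have lttr x y z : lt x y -> lt y z -> lt x z.
  rewrite /lt => nyx nzy; apply/negP => zx.
  have [|m] := Rmin [set w | [\/ w = x, w = y | w = z]].
    by exists x; constructor 1.
  move=> mE mmin; have mx := mmin x (Or31 _ _ erefl).
  have my := mmin y (Or32 _ _ erefl); have mz := mmin z (Or33 _ _ erefl).
  case: mE mx my mz => -> mx my mz.
  - by rewrite -(Ranti _ _ mz zx) my in nzy.
  - by rewrite mx in nyx.
  - by rewrite my in nzy.
have [nobad|/existsNP bad] :=
    pselect (forall x, K x -> [set y | K y /\ ~ lt x y] #<= A).
  by exists K, lt; split.
(* Cut just below the least [x0] whose closed initial segment is too large: earlier segments are
   small by minimality, and removing the single point [x0] leaves the cut too large. *)
have [x0 /not_implyP[Kx0 x0bad] x0min] := Rmin _ bad.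
exists [set y | K y /\ lt y x0], lt; split=> //.
- by move=> y [].
- move=> x [Kx xx0]; apply: (@card_le_trans _ _ _ [set y | K y /\ ~ lt x y]).
    by apply: subset_card_le => y [[Ky _]].
  apply: contrapT => xbad; move: xx0; rewrite /lt x0min //.
  by move=> /(_ Kx).
- move=> TA; apply: x0bad.
  have x0A : [set x0] #<= A.
    by have /infiniteP := Ainf; apply: card_le_trans; exact: countable1.
  apply: card_le_trans (infinite_setU_le Ainf TA x0A).
  apply: subset_card_le => y [Ky /negP]; rewrite negbK => yx0.
  have [x0y|nx0y] := boolP (R x0 y); last by left.
  by right; exact: Ranti.
Qed.

Section Tower.
Context {d : Order.disp_t} {B : ctbDistrLatticeType d}.
Local Open Scope order_scope.

Definition splits n (p : 'I_n -> B) (x : B) : Prop :=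
  exists i j, [/\ i != j, x `&` p i != \bot & x `&` p j != \bot].

Definition pairwise_disjoint n (p : 'I_n -> B) : Prop :=
  forall i j, i != j -> p i `&` p j = \bot.

(** Indexing the cells by ['I_n] makes them children of a tree node; exempting zero lets [X] be
    closed under meets with cells. *)
Definition reapable n U (K : set U) : Prop := forall X : set B, (X #<= K)%card ->
  exists p : 'I_n -> B, pairwise_disjoint p /\
    forall x, X x -> x != \bot -> splits p x.

(* [F P] means that [P] holds of [p_alpha] for all large enough [alpha]. *)
Lemma reaping_tower n U (A : set B) (K : set U) :
  infinite_set A -> (A #<= K)%card -> ~ (K #<= A)%card -> reapable n K ->
  exists (Z : set B) (F : set (set ('I_n -> B))),
  [/\ A `<=` Z /\ (Z #<= K)%card, ~ F set0,
      forall P Q, P `<=` Q -> F P -> F Q,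
      forall I (D : set I) (P : I -> set ('I_n -> B)), (D #<= A)%card ->
        (forall i, D i -> F (P i)) -> F (\bigcap_(i in D) P i) &
      forall y, Z y -> F [set p | [/\ pairwise_disjoint p,
        y != \bot -> splits p y & forall i, Z (y `&` p i)]] ].
Proof.
move=> Ainf AK KA reap.
have [T [lt [TK ltwf lttr Tseg TA]]] := well_founded_long Ainf KA.
have ltasym x y : lt x y -> ~ lt y x.
  elim/(well_founded_ind ltwf): x y => x IH y xy yx; exact: (IH y yx x).
have /choice[P PX] : forall X : set B, exists p : 'I_n -> B, (X #<= K)%card ->
    pairwise_disjoint p /\ forall x, X x -> x != \bot -> splits p x.
  move=> X; have [/reap[p pX]|nX] := pselect (X #<= K)%card; first by exists p.
  by exists (fun=> \bot) => /nX.
(* Stage [a] consists of [A] and all pieces cut from an earlier stage by the partition chosen to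
   reap that stage. *)
pose step a (X : forall b, lt b a -> set B) : set B :=
  A `|` [set z | exists b (ba : lt b a), T b /\
           exists x i, X b ba x /\ z = x `&` P (X b ba) i].
pose X := Fix ltwf (fun=> set B) step.
have XE a z : X a z <-> A z \/ exists b x i,
    [/\ lt b a, T b, X b x & z = x `&` P (X b) i].
  rewrite {1}/X Fix_eq; last first.
    move=> x f g fg; congr (step x _).
    by apply: functional_extensionality_dep => y; apply: functional_extensionality_dep.
  split=> [[Az|[b [ba [Tb [x [i [Xx ->]]]]]]]|[Az|[b [x [i [ba Tb Xx ->]]]]]].
  - by left.
  - by right; exists b, x, i.
  - by left.
  - by right; exists b, ba; split=> //; exists x, i.
have Xmono a b z : lt a b -> X a z -> X b z.
  move=> ab /XE[Az|[c [x [i [ca Tc Xx ->]]]]]; apply/XE; [by left|right].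
  by exists c, x, i; split=> //; exact: lttr ab.
have Xle a : T a -> (X a #<= A)%card.
  elim/(well_founded_ind ltwf): a => a IH Ta.
  have -> : X a = A `|` \bigcup_(b in [set b | T b /\ lt b a])
      \bigcup_(i in [set: 'I_n]) ((fun x => x `&` P (X b) i) @` X b).
    apply/seteqP; split=> z.
      move=> /XE[Az|[b [x [i [ca Tb Xx ->]]]]]; [by left|right].
      by exists b => //; exists i => //; exists x.
    move=> [Az|[b [Tb ba] [i _ [x Xx <-]]]]; apply/XE; [by left|right].
    by exists b, x, i.
  apply: infinite_setU_le => //; apply: infinite_bigcup_le => //.
    apply: card_le_trans (Tseg a Ta); apply: subset_card_le => b [Tb ba].
    by split=> //; exact: ltasym.
  move=> b [Tb ba]; apply: infinite_bigcup_le => //.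
    have /infiniteP := Ainf; apply: card_le_trans.
    exact: (countableP [set: 'I_n]).
  by move=> i _; apply: card_le_trans (IH b ba Tb); exact: card_image_le.
have Kinf : infinite_set K.
  by apply: contra_not Ainf; exact: card_le_finite.
(* Regularity of the successor: without a bound, [T] would be a union of at most [|A|] segments,
   each of size at most [|A|]. *)
have unb D (f : D -> U) (I : set D) : (I #<= A)%card -> (forall i, I i -> T (f i)) ->
    exists2 b, T b & forall i, I i -> lt (f i) b.
  move=> IA fT; apply: contrapT => nb; apply: TA.
  apply: (card_le_trans _ (infinite_bigcup_le Ainf IA
    (fun i Ii => Tseg _ (fT i Ii)))).
  apply: subset_card_le => b Tb; apply: contrapT => nU; apply: nb.
  exists b => // i Ii; apply: contrapT => nlt; apply: nU.
  by exists i.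
have next a : T a -> exists2 b, T b & lt a b.
  move=> Ta; have [||b Tb ab] := @unb unit (fun=> a) setT.
  - by have /infiniteP := Ainf; apply: card_le_trans; exact: countableP.
  - by [].
  - by exists b => //; exact: (ab tt).
have [a0 Ta0] : exists a, T a.
  apply: contrapT => nT; apply: TA; rewrite (_ : T = set0) //.
  by rewrite -subset0 => x Tx; apply: nT; exists x.
exists (\bigcup_(a in T) X a).
exists [set S | exists2 a, T a & forall b, T b -> lt a b -> S (P (X b))].
split.
- split; first by move=> x Ax; exists a0 => //; apply/XE; left.
  apply: infinite_bigcup_le => //; first exact: subset_card_le.
  by move=> a Ta; apply: card_le_trans (Xle a Ta) AK.
- by move=> [a Ta aF]; have [b Tb ab] := next a Ta; exact: (aF b).
- by move=> S S' SS' [a Ta aS]; exists a => // b Tb ab; apply: SS'; exact: aS.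
- move=> I D S DA FS.
  have /choice[f fP] : forall i, exists a, D i ->
      T a /\ forall b, T b -> lt a b -> S i (P (X b)).
    move=> i; have [/FS[a Ta aS]|nD] := pselect (D i); first by exists a.
    by exists a0 => /nD.
  have [|b Tb fb] := unb _ f _ DA; first by move=> i /fP[].
  exists b => // c Tc bc i Di; apply: (fP i Di).2 => //.
  by apply: lttr bc; exact: fb.
- move=> y [a Ta Xy]; exists a => // b Tb ab.
  have [Pdisj Psplit] := PX (X b) (card_le_trans (Xle b Tb) AK).
  split=> // [|i]; first by apply: Psplit; exact: Xmono Xy.
  have [c Tc bc] := next b Tb; exists c => //; apply/XE; right.
  by exists b, y, i; split=> //; exact: Xmono Xy.
Qed.

End Tower.

(** * Colourings *)

(** Greedy choice: each of the at most [n] clauses with a large [D] gets its own point of [D],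
    coloured against [e]. In [greedy], [V] collects the points already taken. *)
Lemma two_coloring (J : finType) (n : nat) (E : {set {set J} * bool}) :
  (#|E| <= n)%N -> exists chi : J -> bool, forall D e, (D, e) \in E ->
    (n <= #|D|)%N -> exists2 j, j \in D & chi j != e.
Proof.
move=> En.
have greedy (s : seq ({set J} * bool)) (V : {set J}) :
    (forall u, u \in s -> (size s + #|V| <= #|u.1|)%N) ->
    exists chi : J -> bool, forall u, u \in s ->
      exists j, [/\ j \in u.1, j \notin V & chi j != u.2].
  elim: s V => [|u s IH] V sV; first by exists xpredT.
  have [j ju jV] : exists2 j, j \in u.1 & j \notin V.
    apply/subsetPn/negP => /subset_leq_card; apply/negP; rewrite -ltnNge.
    by apply: leq_trans (sV u (mem_head _ _)); rewrite /= addSn ltnS leq_addl.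
  have [v vs|chi chiP] := IH (j |: V)%SET.
    apply: leq_trans (sV v _); last by rewrite in_cons vs orbT.
    by rewrite cardsU1 jV /= addnA addn1 addSn.
  exists (fun i => if i == j then ~~ u.2 else chi i) => v.
  rewrite in_cons => /predU1P[->|/chiP[i [iv]]].
    by exists j; rewrite eqxx; split => //; case: (u.2).
  by rewrite !inE negb_or => /andP[/negPf ij iV] chii; exists i; rewrite ij.
pose s : seq ({set J} * bool) := filter (fun u : {set J} * bool => (n <= #|u.1|)%N) (enum E).
have [u|chi chiP] := greedy s finset.set0.
  rewrite mem_filter cards0 addn0 => /andP[nu _]; apply: leq_trans nu.
  by apply: leq_trans En; rewrite cardE size_filter count_size.
exists chi => D e DE nD.
by have [|j [jD _ je]] := chiP (D, e); [rewrite mem_filter nD mem_enum|exists j].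
Qed.

(** * The iterated quantifier over large sets of partitions *)

Section Frequently.
Context {T V : Type} (A : set V) (F : set (set T)).
Hypotheses (F0 : ~ F set0) (Fmono : forall P Q, P `<=` Q -> F P -> F Q).
Hypothesis Fcap : forall I (D : set I) (P : I -> set T), D #<= A ->
  (forall i, D i -> F (P i)) -> F (\bigcap_(i in D) P i).

(* [phi [:: p_1; ...; p_k]] holds for unboundedly many [p_1], then for
   unboundedly many [p_2] depending on [p_1], and so on. *)
Fixpoint frequently (k : nat) (phi : seq T -> Prop) : Prop :=
  if k is l.+1 then ~ F [set p | ~ frequently l (fun s => phi (p :: s))]
  else phi [::].

Lemma frequentlyW k (phi psi : seq T -> Prop) :
  (forall s, phi s -> psi s) -> frequently k phi -> frequently k psi.
Proof.
elim: k phi psi => [|k IH] phi psi pp /=; first exact: pp.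
apply: contra_not; apply: Fmono => p; apply: contra_not.
by apply: IH => s; exact: pp.
Qed.

(** If every [i] failed, each would fail on a set in [F]; these sets have a common point [p] since
    [F] is closed under [|A|] intersections, and the induction hypothesis after [p] is
    contradicted. *)
Lemma frequently_pigeonhole k I (D : set I) (phi : I -> seq T -> Prop) :
  D #<= A -> (forall s, exists2 i, D i & phi i s) ->
  exists2 i, D i & frequently k (phi i).
Proof.
move=> DA; elim: k phi => [|k IH] phi phiP /=; first exact: phiP.
apply: contrapT => nfreq; apply: F0.
have : F (\bigcap_(i in D) [set p | ~ frequently k (fun s => phi i (p :: s))]).
  by apply: Fcap => // i Di; apply: contrapT => nF; apply: nfreq; exists i.
apply: Fmono => p pP.
have [i Di] := IH (fun i s => phi i (p :: s)) (fun s => phiP _).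
exact: pP.
Qed.

End Frequently.

(** * Walking down the tree of cells *)

Section Strategy.
Context {d : Order.disp_t} {B : ctbDistrLatticeType d}.
Local Open Scope order_scope.

(** Each round reaps all pieces of members of [Z] cut by [q]; refining every [q j] by the resulting
    cells at least doubles the number of members met. *)
Lemma fine_family n U (K : set U) (Z : set B) : infinite_set K ->
  (Z #<= K)%card -> reapable (B := B) n K -> forall m,
  exists (J : finType) (q : J -> B),
    (forall i j, i != j -> q i `&` q j = \bot) /\
    forall y, Z y -> y != \bot ->
    (2 ^ m <= #|[set j | y `&` q j != \bot]%SET|)%N.
Proof.
move=> Kinf ZK reap; elim=> [|m [J [q [qdisj qP]]]].
  exists unit, (fun=> \top); split=> [[] []//|y _ y0]; rewrite expn0 card_gt0.
  by apply/set0Pn; exists tt; rewrite inE meetx1.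
have [|p [pdisj pP]] := reap (\bigcup_(j in [set: J]) ((fun y => y `&` q j) @` Z)).
  apply: infinite_bigcup_le => //.
    by have /infiniteP := Kinf; apply: card_le_trans; exact: countableP.
  by move=> j _; apply: card_le_trans ZK; exact: card_image_le.
exists (J * 'I_n)%type, (fun u => q u.1 `&` p u.2).
split=> [[j i] [j' i']|y Zy y0] /=.
  rewrite meetACA xpair_eqE negb_and => /orP[/qdisj ->|/pdisj ->].
    by rewrite meet0x.
  by rewrite meetx0.
have -> : #|[set u : J * 'I_n | y `&` (q u.1 `&` p u.2) != \bot]%SET| =
    \sum_(j in [set j | y `&` q j != \bot]%SET)
      #|[set i | (y `&` q j) `&` p i != \bot]%SET|.
  under eq_bigr do rewrite -sum1_card.
  rewrite -sum1_card pair_big_dep; apply: eq_bigl => -[j i]; rewrite !inE /= meetA.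
  have [->|//] := eqVneq (y `&` q j) \bot.
  by rewrite meet0x eqxx.
rewrite expnS mulnC; apply: (@leq_trans
  (\sum_(j in [set j | y `&` q j != \bot]%SET) 2)%N).
  by rewrite sum_nat_const leq_mul2r /= qP.
apply: leq_sum => j; rewrite inE => yj0.
have [|i [i' [ii' yi yi']]] := pP (y `&` q j) _ yj0.
  by exists j => //; exists y.
apply/card_gt1P; exists i, i'; by rewrite !inE.
Qed.

Definition decided (e : bool) (y c : B) : bool :=
  if e then y <= c else y `&` c == \bot.

Lemma decidedS e y y' c : y' <= y -> decided e y c -> decided e y' c.
Proof.
case: e => /= yy'; first exact: le_trans.
by rewrite -!lex0; apply: le_trans; exact: leI2.
Qed.

(** Since the cells are disjoint, the join agrees with [c i] inside [p i], so a decision passes to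
    every child. *)
Lemma decided_piece e n (p c : 'I_n -> B) y i : pairwise_disjoint p ->
  decided e y (\join_(j < n) (p j `&` c j)) -> decided e (y `&` p i) (c i).
Proof.
move=> pdisj; case: e => /= yc; last first.
  rewrite -lex0 -(eqP yc) -meetA leI2 //.
  exact: (@joins_sup _ _ _ i xpredT (fun j => p j `&` c j)).
have : \join_(j < n) (p j `&` c j) <= c i `|` ~` p i.
  apply/joinsP => j _; have [->|ji] := eqVneq j i.
    by apply: le_trans (leUl _ _); exact: leIr.
  apply: le_trans (leUr _ _); apply: le_trans (leIl _ _) _.
  by rewrite -disj_leC pdisj.
move=> /(le_trans yc) /(leI2 (lexx (p i))).
by rewrite meetC meetUr meetxC joinx0 => /le_trans; apply; exact: leIr.
Qed.

Section Walk.
Variables (n : nat) (J : finType) (q : J -> B).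
Hypothesis qdisj : forall i j, i != j -> q i `&` q j = \bot.
Variable chi : {set {set J} * bool} -> J -> bool.

(* Each branching of the tree discards from [E] the clause attached to the
   chosen child; at a leaf the surviving clauses are avoided by [chi E]. *)
Fixpoint tree (k : nat) (E : {set {set J} * bool}) (s : seq ('I_n -> B)) : B :=
  if k is l.+1 then
    \join_(i < n) (head (fun=> \bot) s i `&`
      tree l (E :\ nth (finset.set0, true) (enum E) i)%SET (behead s))
  else \join_(j | chi E j) q j.

Hypothesis chiP : forall (E : {set {set J} * bool}) (D : {set J}) (e : bool),
  #|E| = n -> (D, e) \in E -> (n <= #|D|)%N ->
  exists2 j, j \in D & chi E j != e.

Variables (Z : set B) (F : set (set ('I_n -> B))).
Hypothesis Fmono : forall P Q, P `<=` Q -> F P -> F Q.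
Hypothesis Fstep : forall y, Z y -> F [set p | [/\ pairwise_disjoint p,
  y != \bot -> splits p y & forall i, Z (y `&` p i)]].

Let supp y : {set J} := [set j | y `&` q j != \bot]%SET.
Hypothesis suppP : forall y, Z y -> y != \bot -> (n <= #|supp y|)%N.

(** Induction on the depth. A child met by [y] has the same support by minimality, and [E] loses one
    clause other than [(supp y, e)]. At a leaf, [chi E] gives some [q j] met by [y] the colour
    opposite to [e]. *)
Lemma no_frequent_decision k (E : {set {set J} * bool}) y e : #|E| = (k + n)%N -> Z y -> y != \bot ->
  (forall z, Z z -> z != \bot -> z <= y -> supp z = supp y) ->
  (supp y, e) \in E ->
  ~ frequently F k (fun s => decided e y (tree k E s)).
Proof.
elim: k E y => [|k IH] E y Ek Zy y0 ymin yE /=.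
  have [j] := chiP Ek yE (suppP Zy y0).
  rewrite inE => /negP yj chij yc; apply: yj; rewrite -lex0.
  have {chij} : chi E j = ~~ e by move: chij; case: (chi E j); case: (e).
  case: e {yE} yc => /= [yc|/eqP <-] chij; last by rewrite leI2 // joins_sup.
  apply: le_trans (leI2 yc (lexx _)) _.
  rewrite meetC joins_disjoint // => i chii; apply: qdisj.
  by apply: contraTneq chii => <-; rewrite chij.
move=> nF; apply: nF; apply: Fmono (Fstep Zy) => p [pdisj ps Zp] freq.
have [i [i' [ii' yi yi']]] := ps y0.
pose ej (j : 'I_n) := nth (finset.set0, true) (enum E) j.
have jE (j : 'I_n) : (j < size (enum E))%N by rewrite -cardE Ek ltn_addl.
have eE j : ej j \in E by rewrite -mem_enum mem_nth.
(* The clause [(supp y, e)] is discarded along at most one child, and [p] splits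
   [y], so some child met by [y] keeps it. *)
have [j [yj je]] : exists j, y `&` p j != \bot /\ ej j != (supp y, e).
  have [eie|] := eqVneq (ej i) (supp y, e); last by exists i.
  exists i'; split=> //; rewrite -eie; apply: contra ii' => /eqP/esym/eqP.
  by rewrite nth_uniq ?enum_uniq.
have supp_yj : supp (y `&` p j) = supp y by apply: ymin => //; exact: leIl.
apply: (IH (E :\ ej j)%SET (y `&` p j)) => //.
- by have := cardsD1 (ej j) E; rewrite eE Ek addSn => -[].
- move=> z Zz z0 zy; rewrite supp_yj; apply: ymin => //.
  by apply: le_trans zy _; exact: leIl.
- by rewrite supp_yj !inE eq_sym je.
- apply: frequentlyW freq => // s /=.
  exact: (@decided_piece _ _ _ (fun i => tree k (E :\ ej i)%SET s)).
Qed.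

End Walk.

Lemma reaping_contradiction n U (A : set B) (K : set U) : infinite_set A ->
  (A #<= K)%card -> ~ (K #<= A)%card -> reapable (B := B) n K ->
  (forall c, exists2 a, A a /\ a != \bot & exists e, decided e a c) -> False.
Proof.
move=> Ainf AK KA reap Adec.
have [Z [F [[AZ ZK] F0 Fmono Fcap Fstep]]] := reaping_tower Ainf AK KA reap.
have Kinf : infinite_set K by apply: contra_not Ainf; exact: card_le_finite.
have [J [q [qdisj qP]]] := fine_family Kinf ZK reap n.
pose supp y : {set J} := [set j | y `&` q j != \bot]%SET.
have suppP y : Z y -> y != \bot -> (n <= #|supp y|)%N.
  by move=> Zy y0; apply: leq_trans (qP y Zy y0); exact/ltnW/ltn_expl.
have /choice[chi chiP] : forall E : {set {set J} * bool},
    exists chi : J -> bool, #|E| = n -> forall D e, (D, e) \in E ->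
      (n <= #|D|)%N -> exists2 j, j \in D & chi j != e.
  move=> E; have [En|nEn] := pselect (#|E| = n); last by exists xpredT => /nEn.
  by have [|chi chiP] := @two_coloring J n E; [rewrite En|exists chi].
(* All clauses are present at the root and one leaves per level, so depth [k] leaves exactly [n] at
   a leaf, the size for which [chiP] speaks. *)
pose E0 : {set {set J} * bool} := [set: {set J} * bool]%SET.
have nE0 : (n <= #|E0|)%N.
  have [a [Aa a0] _] := Adec \top.
  apply: leq_trans (suppP a (AZ _ Aa) a0) _; apply: leq_trans (max_card _) _.
  have cJ : #|{set J}| = (2 ^ #|J|)%N.
    by have := card_powerset [set: J]%SET; rewrite powersetT !cardsT.
  rewrite cardsT card_prod card_bool cJ.
  apply: leq_trans (ltnW (ltn_expl _ (leqnn 2))) _; exact: leq_pmulr.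
pose k := (#|E0| - n)%N; have kE0 : #|E0| = (k + n)%N by rewrite subnK.
have [|s|[a e] [Aa a0] freq] := @frequently_pigeonhole _ _ A F F0 Fmono Fcap k
    _ [set u : B * bool | A u.1 /\ u.1 != \bot]
    (fun u s => decided u.2 u.1 (tree q chi k E0 s)).
- apply: (@card_le_trans _ _ _ (\bigcup_(e in [set: bool]) ((fun a => (a, e)) @` A))).
    by apply: subset_card_le => -[a e] /= [Aa _]; exists e => //; exists a.
  apply: infinite_bigcup_le => // [|e _]; last exact: card_image_le.
  by have /infiniteP := Ainf; apply: card_le_trans; exact: countableP.
- by have [a Aa [e ae]] := Adec (tree q chi k E0 s); exists (a, e).
(* Supports shrink downwards, so an element below [a] with support of least size shares its support
   with every nonzero member of [Z] below it. *)
pose below m := `[< exists y, [/\ Z y, y != \bot, y <= a & #|supp y| = m] >].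
have exb : exists m, below m.
  by exists #|supp a|; apply/asboolP; exists a; split=> //; exact: AZ.
case: (ex_minnP exb) => m /asboolP[y [Zy y0 ya ym]] mmin.
apply: (no_frequent_decision qdisj (chi := chi) _ Fmono Fstep suppP kE0 Zy y0).
- by move=> E D e' En; exact: chiP.
- move=> z Zz z0 zy; apply/eqP; rewrite eqEcard; apply/andP; split.
    apply/fintype.subsetP => j; rewrite !inE; apply: contra => /eqP yj.
    by rewrite -lex0 -yj leI2.
  rewrite ym; apply: mmin; apply/asboolP; exists z; split=> //.
  exact: le_trans ya.
- by rewrite inE.
- by apply: frequentlyW freq => // s; exact: decidedS.
Qed.

(** Induction on the list: cut [u] into its parts inside and outside the head, split each part
    separately, and join the results; whatever meets [u] meets one of the parts. *)
Lemma finite_split (A : seq B) :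
  (forall a : B, a != \bot -> exists c, a `&` c != \bot /\ a `&` ~` c != \bot) ->
  forall u : B, exists2 c, c <= u & forall a, a \in A -> a `&` u != \bot ->
    a `&` c != \bot /\ a `&` u `&` ~` c != \bot.
Proof.
have lt_bot (x y : B) : x <= y -> x != \bot -> y != \bot.
  by move=> xy; apply: contra => /eqP y0; rewrite -lex0 -y0.
move=> nonatom; elim: A => [|a A IH] u; first by exists \bot; [exact: le0x|move=> a; rewrite in_nil].
have [v0|v0] := eqVneq (a `&` u) \bot.
  have [c cu cP] := IH u; exists c => // x; rewrite in_cons.
  by move=> /predU1P[->|/cP//]; rewrite v0 eqxx.
pose v := a `&` u; pose w := ~` a `&` u.
(* If some [x] in the tail meets [v], the splitting of [x] already splits [v]; otherwise only [v]
   itself has to be split, by [nonatom]. *)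
have [c [cv [vc vc'] cP]] : exists c, [/\ c <= v, c != \bot /\ v `&` ~` c != \bot &
    forall x, x \in A -> x `&` v != \bot ->
      x `&` c != \bot /\ x `&` v `&` ~` c != \bot].
  have [[x xA xv]|nx] := pselect (exists2 x, x \in A & x `&` v != \bot).
    have [c cv cP] := IH v; exists c; split=> //.
    have [xc xc'] := cP x xA xv; split; first exact: lt_bot (leIr _ _) xc.
    by apply: lt_bot xc'; rewrite leI2 // leIr.
  have [c [vc vc']] := nonatom v v0; exists (v `&` c); split=> //.
  - exact: leIl.
  - by split=> //; rewrite complI meetUr meetxC join0x.
  - by move=> x xA xv; case: nx; exists x.
have [c' c'w c'P] := IH w.
have vw : v `&` w = \bot by rewrite meetACA meetxC meet0x.
have vU : v `&` ~` (c `|` c') = v `&` ~` c.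
  rewrite complU meetA; apply/meet_idPl; apply: le_trans (leIl _ _) _.
  by rewrite -disj_leC -lex0 -vw leI2.
have wU : w `&` ~` (c `|` c') = w `&` ~` c'.
  rewrite complU meetCA; apply/meet_idPr; apply: le_trans (leIl _ _) _.
  by rewrite -disj_leC -lex0 -vw meetC leI2.
have vu : v <= u by exact: leIr.
have wu : w <= u by exact: leIr.
exists (c `|` c'); first by rewrite leUx (le_trans cv vu) (le_trans c'w wu).
move=> x; rewrite in_cons => /predU1P[-> _|xA xu].
  split; last by rewrite -/v vU.
  apply: lt_bot vc; rewrite lexI leUl andbT.
  by apply: le_trans cv _; exact: leIl.
have [xv|xv] := eqVneq (x `&` v) \bot.
  have xw : x `&` w != \bot.
    apply: contra xu => /eqP xw; rewrite -[u]meet1x -(joinxC a) meetUl meetUr.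
    by rewrite -/v -/w xv xw join0x.
  have [xc xc'] := c'P x xA xw; split.
    by apply: lt_bot xc; rewrite leI2 // leUr.
  by apply: lt_bot xc'; rewrite -meetA -wU meetA leI2 // leI2.
have [xc xc'] := cP x xA xv; split.
  by apply: lt_bot xc; rewrite leI2 // leUl.
by apply: lt_bot xc'; rewrite -meetA -vU meetA leI2 // leI2.
Qed.

(** * From reaping numbers to splitting, and the conclusion *)

Lemma not_unreaped_splits n (X : set B) : (0 < n)%N ->
  (forall a, X a -> a != \bot) -> ~ unreaped n X ->
  exists p : 'I_n -> B, pairwise_disjoint p /\ forall x, X x -> splits p x.
Proof.
case: n => // n _ X0 nun.
have [R [[Rn _ Rdisj] Rreap]] : exists R, reaped_by n.+1 X R.
  by apply: contrapT => /forallNP nR; apply: nun; split.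
pose r := enum_fset R.
have rn : size r = n.+1 by rewrite -Rn.
have ru : uniq r by exact: fset_uniq.
pose p (i : 'I_n.+1) := nth \bot r i.
have pR i : p i \in R by apply: mem_nth; rewrite rn.
have Rp b : b \in R -> exists i, p i = b.
  move=> bR; have lt : (index b r < n.+1)%N by rewrite -rn index_mem.
  by exists (Ordinal lt); rewrite /p nth_index.
exists p; split=> [i j ij|x Xx].
  by apply: Rdisj => //; rewrite nth_uniq ?rn.
have := Rreap x Xx; set G := [fset b in R | _]%fset => G2.
have GP k : (k < 2)%N -> exists2 i, p i = nth \bot (enum_fset G) k & x `&` p i != \bot.
  move=> k2; have : nth \bot (enum_fset G) k \in G.
    by apply: mem_nth; exact: leq_trans G2.
  by rewrite !inE /= => /andP[/Rp[i <-] ?]; exists i; rewrite // meetC.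
have [i iE xi] := GP 0%N isT; have [j jE xj] := GP 1%N isT.
exists i, j; split=> //; apply/eqP => ij.
have : nth \bot (enum_fset G) 0 == nth \bot (enum_fset G) 1 by rewrite -iE -jE ij.
by rewrite nth_uniq ?fset_uniq //; exact: leq_trans G2.
Qed.

(** The pair of [c] and its complement is a 2-partition, distinct because the algebra is nontrivial.
    It fails to reap [A], so some [a] misses one of its two cells. *)
Lemma unreaped2_decided (A : set B) (c : B) : (\bot : B) != \top -> unreaped 2 A ->
  exists2 a, A a /\ a != \bot & exists e, decided e a c.
Proof.
move=> B01 [A0 Aunr]; apply: contrapT => nA.
have cC : c != ~` c.
  by apply: contra B01 => /eqP cE; rewrite -(meetxC c) -cE meetxx -(joinxx c) {2}cE joinxC.
apply: (Aunr [fset c; ~` c]%fset); split; first split.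
- by rewrite cardfs2 cC.
- by rewrite big_fsetU1 ?inE //= big_seq_fset1 joinxC.
- move=> x y; rewrite !inE => /orP[]/eqP-> /orP[]/eqP->; rewrite ?eqxx //.
    by rewrite meetxC.
  by rewrite meetC meetxC.
move=> a Aa; rewrite (_ : [fset b in _ | _]%fset = [fset c; ~` c]%fset).
  by rewrite cardfs2 cC.
apply/fsetP => b; rewrite !inE /=; case: (b =P c) => [->|_] /=.
  apply/negP => /eqP ac; apply: nA; exists a; first by split=> //; exact: A0.
  by exists false; rewrite /= meetC ac.
case: eqP => // -> /=; apply/negP => /eqP ac; apply: nA.
exists a; first by split=> //; exact: A0.
by exists true; rewrite /= -[c]complK -disj_leC meetC ac.
Qed.

End Strategy.

Theorem theorem3p6 (n : nat) (d : Order.disp_t) (B : ctbDistrLatticeType d) :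
  (2 <= n)%N -> (reaping_number n B #<= succ_card (reaping_number 2 B))%card.
Proof.
move=> n2; apply: contrapT => nle.
have n0 : (0 < n)%N by exact: ltnW.
have [_ rmin] := reaping_numberP B n2.
have [Aunr _] := reaping_numberP B (leqnn 2).
move: Aunr nle; set A := reaping_number 2 B => Aunr; set K := succ_card A => nle.
have [AK KA _] : is_succ_card A K := succ_cardP A.
(* If the nonzero members of [X] were unreaped, their number would bound the reaping number for [n]
   by [K], against [nle]. *)
have reap : reapable (B := B) n K.
  move=> X XK; have [||p [pdisj pP]] := @not_unreaped_splits _ B n
      [set x | X x /\ x != \bot%O] n0.
  - by move=> a [].
  - move=> /rmin /card_le_trans Xle; apply: nle; apply: Xle.
    by apply: card_le_trans XK; apply: subset_card_le => x [].
  - by exists p; split=> // x Xx x0; exact: pP.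
have nonatom (a : B) : (a != \bot -> exists c, a `&` c != \bot /\ a `&` ~` c != \bot)%O.
  move=> a0; have [|p [pdisj pP]] := reap [set a].
    have [k Kk] : exists k, K k.
      apply: contrapT => nK; apply: KA; rewrite (_ : K = set0) //.
      by rewrite -subset0 => k Kk; apply: nK; exists k.
    by apply: (@card_le_inj _ _ _ _ (fun=> k)) => // x y /= -> ->.
  have [i [j [ij ai aj]]] := pP a erefl a0; exists (p i); split=> //.
  apply: contra aj => /eqP ac; rewrite -lex0 -ac leI2 //.
  by rewrite -disj_leC pdisj // eq_sym.
(* A one-element algebra has no [n] distinct elements, so the empty set would be unreaped and the
   reaping number zero. *)
have B01 : (\bot : B)%O != \top%O.
  apply/eqP => B01.
  have x0 (x : B) : x = \bot%O by apply/eqP; rewrite -lex0 B01 lex1.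
  have un0 : unreaped n (set0 : set B).
    split=> // R [[Rn _ _] _]; move: n2; rewrite -Rn leqNgt => /negP; apply.
    rewrite ltnS -(cardfs1 (\bot%O : B)); apply: fsubset_leq_card.
    by apply/fsubsetP => b _; rewrite inE (x0 b).
  by apply: nle; apply: card_le_trans (rmin _ un0) _.
have Adec := fun c => unreaped2_decided c B01 Aunr.
(* For finite [A], one element [c] splits all members of [A] at once, while [Adec] provides a member
   that [c] does not split. *)
have [Afin|Ainf] := pselect (finite_set A); last first.
  exact: (reaping_contradiction Ainf AK KA reap Adec).
have /finite_seqP[s sA] := Afin.
have [c _ cP] := finite_split s nonatom \top%O.
have [a [Aa a0] [e]] := Adec c.
have [||ac ac'] := cP a; rewrite ?meetx1 //.
  by move: Aa; rewrite sA.
rewrite meetx1 in ac'; case: e => /= aC; last by rewrite aC in ac.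
by rewrite disj_leC complK aC in ac'.
Qed.
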